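(* There is an absolute constant $C>0$ such that for every prime power $q$ and all integers $n\ge m\ge 1$ with $n\ge 2$, $$0\le\mathbb{P}(f_n\text{ is }m\text{-smooth})-\mathbb{P}(\pi_n\text{ is }m\text{-smooth})\le\frac{C}{m\,q^{\lceil\frac{m+1}{2}\rceil}} .$$
   Context: $\pi_n$ is a uniformly random permutation in the symmetric group $S_n$. $f_n=f_{n,q}$ is a uniformly random element of the set of monic polynomials of degree $n$ over the finite field $\mathbb{F}_q$. A permutation is $m$-smooth if all its cycles have length at most $m$. A polynomial over $\mathbb{F}_q$ is $m$-smooth if all its irreducible factors have degree at most $m$. *)

(* Defs.v *)
From mathcomp Require Import all_boot all_order all_algebra all_fingroup.
From mathcomp Require Import boolp reals.

Set Implicit Arguments.
Unset Strict Implicit.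
Unset Printing Implicit Defensive.

Import GRing.Theory Num.Theory.
Local Open Scope ring_scope.

(* Probability of E under the uniform distribution on A (equal to 0 when A is
   empty, by the convention x / 0 = 0). *)
Definition unif_prob (R : realType) (T : finType) (A : {set T})
    (E : T -> Prop) : R :=
  #|[set x in A | `[< E x >]]|%:R / #|A|%:R.

(* porbits s also contains the fixed points of s, as orbits of cardinal 1. *)
Definition smooth_perm (m : nat) (T : finType) (s : {perm T}) : Prop :=
  forall c : {set T}, c \in porbits s -> (#|c| <= m)%N.

(* The degree of a nonzero polynomial g is (size g).-1. *)
Definition smooth_poly (m : nat) (F : fieldType) (f : {poly F}) : Prop :=
  forall g : {poly F}, irreducible_poly g -> g %| f -> ((size g).-1 <= m)%N.

(* {poly F} is infinite, so the monic polynomials of degree n are collected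
   inside the finite type {poly_(n.+1) F} of polynomials of size at most n.+1. *)
Definition monic_of_degree (F : finFieldType) (n : nat) :
    {set {poly_(n.+1) F}} :=
  [set f : {poly_(n.+1) F} | (polyn f \is monic) && (size f == n.+1)].

(* Main.v *)
Require Import Defs.
From mathcomp Require Import all_boot all_order all_algebra all_fingroup.
From mathcomp Require Import boolp reals.
From mathcomp Require Import zify ring lra.

(** Write p_n and P_n for the probabilities that the permutation and the
    polynomial are m-smooth.  Both sequences obey a linear recurrence for
    n times the n-th term, the discrete form of the logarithmic derivative of
    the generating function:

      n p_n = sum of p_{n-i} over 1 <= i <= min(m, n)     [perm_prob_rec]
      n P_n = sum of a_i P_{n-i} over 1 <= i <= n         [poly_prob_rec]

    where q^i a_i is the sum of deg P over the monic irreducible P with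
    deg P <= m and deg P | i.  The first recurrence splits a permutation
    according to the cycle of one point.  The second counts the degree of each
    smooth f as the sum of deg P over the pairs (P, j) such that P^j divides f,
    and exchanges the summations.

    When n <= m every polynomial of degree n is smooth, so P_n = 1 and the
    second recurrence forces a_i = 1 for 1 <= i <= m: this is the identity
    q^i = sum of deg P over deg P | i, obtained here without any theory of
    finite fields.  When i > m, a divisor of i that is at most m is at most
    i / 2, whence 0 <= a_i <= 2 q^(floor(i / 2) - i).

    Therefore D_n = P_n - p_n satisfies
      n D_n = sum_{i <= min(m, n)} D_{n-i} + sum_{m < i <= n} a_i P_{n-i}.
    All terms are nonnegative, which gives D_n >= 0.  Moreover D_n vanishes
    for n <= m, the second sum is at most S = sum_{i > m} a_i, and at most
    n - 1 - m terms of the first sum are nonzero; by induction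
    D_n <= S / (m + 1) [recurrence_comparison].  As S is bounded by
    8 q^(- ceil((m + 1) / 2)), the constant C = 8 works. *)

Set Implicit Arguments.
Unset Strict Implicit.
Unset Printing Implicit Defensive.

Import Order.TTheory GRing.Theory Num.Theory.
Local Open Scope ring_scope.

(** * Counting smooth polynomials *)

Section PolynomialCount.
Variable F : finFieldType.
Implicit Types (f g P Q : {poly F}) (m n : nat).

(** A list in [{poly F}] rather than a set in [{poly_(n.+1) F}], so that the
    polynomials of all degrees live in one type and can be multiplied. *)
Definition monics n : seq {poly F} :=
  [seq polyn p | p <- enum (monic_of_degree F n)].

Lemma mem_monics n f : (f \in monics n) = (f \is monic) && (size f == n.+1).
Proof.
apply/mapP/andP => [[p]|[fm /eqP sf]].
  by rewrite mem_enum inE => /andP[pm /eqP sp] ->; rewrite sp eqxx.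
have sf' : (size f <= n.+1)%N by rewrite sf.
exists (npolyp n.+1 f); last by rewrite npolypK.
by rewrite mem_enum inE npolypK // fm sf eqxx.
Qed.

Lemma monics_uniq n : uniq (monics n).
Proof. by rewrite map_inj_uniq ?enum_uniq //; apply: val_inj. Qed.

Lemma card_monic_of_degree n : #|monic_of_degree F n| = (#|F| ^ n)%N.
Proof.
have sizeXn (p : {poly_n F}) : (size (polyn p) < size ('X^n : {poly F})%R)%N.
  by rewrite size_polyXn ltnS size_npoly.
have szadd (p : {poly_n F}) : (size ('X^n + polyn p)%R <= n.+1)%N.
  by rewrite size_polyDl // size_polyXn.
pose up (p : {poly_n F}) := npolyp n.+1 ('X^n + polyn p).
have up_inj : injective up.
  move=> p p' /(congr1 (@polyn _ _)); rewrite !npolypK // => /addrI.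
  exact: val_inj.
rewrite -(card_npoly F n) -cardsT -(card_imset _ up_inj).
apply: eq_card => f; rewrite inE; apply/andP/imsetP => [[fm /eqP sf]|[p _ ->]].
  have sd : (size (polyn f - 'X^n)%R <= n)%N.
    apply/leq_sizeP => j; rewrite coefB coefXn leq_eqVlt => /orP[/eqP <-|nj].
      by move: fm; rewrite monicE lead_coefE sf eqxx => /eqP ->; rewrite subrr.
    by rewrite nth_default ?sf // gtn_eqF // subr0.
  exists (npolyp n (polyn f - 'X^n)) => //; apply: val_inj; rewrite /up.
  by rewrite [RHS]npolypK ?szadd // npolypK // addrC subrK.
rewrite npolypK // monicE lead_coefDl // lead_coefXn eqxx.
by rewrite size_polyDl // size_polyXn.
Qed.

Lemma size_monics n : size (monics n) = (#|F| ^ n)%N.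
Proof. by rewrite size_map -cardE card_monic_of_degree. Qed.

Definition irreds m : seq {poly F} :=
  [seq polyn p | p <- enum {poly_m.+1 F} &
     (polyn p \is monic) && irreducibleb (polyn p)].

Lemma mem_irreds m P :
  (P \in irreds m) = [&& P \is monic, irreducibleb P & (size P <= m.+1)%N].
Proof.
apply/mapP/and3P => [[p]|[Pm Pi sP]].
  by rewrite mem_filter => /andP[/andP[pm pi] _] ->.
exists (npolyp m.+1 P); last by rewrite npolypK.
by rewrite mem_filter npolypK // Pm Pi mem_enum.
Qed.

Lemma irreds_uniq m : uniq (irreds m).
Proof.
rewrite map_inj_uniq; first by rewrite filter_uniq ?enum_uniq.
exact: val_inj.
Qed.

Lemma irreducible_divisor f : (1 < size f)%N ->
  exists2 P, (P \is monic) && irreducibleb P & P %| f.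
Proof.
have [n] := ubnP (size f); elim: n f => // n IH f sfn sf1.
have [fi|] := boolP (irreducibleb f).
  have f0 := irredp_neq0 (irreducibleP _ fi).
  have l0 : (lead_coef f)^-1 != 0 by rewrite invr_eq0 lead_coef_eq0.
  have fe : (lead_coef f)^-1 *: f %= f by rewrite eqp_scale.
  exists ((lead_coef f)^-1 *: f); last by rewrite (eqp_dvdl _ fe).
  apply/andP; split; first by rewrite monicE lead_coefZ mulVf ?lead_coef_eq0.
  apply/irreducibleP; have [_ Hf] := irreducibleP _ fi.
  split; first by rewrite (eqp_size fe).
  move=> q sq; rewrite (eqp_dvdr _ fe) => /(Hf q sq) qf.
  by rewrite (eqp_trans qf) // eqp_sym.
rewrite /irreducibleb sf1 /= negb_forall => /existsP[q].
rewrite negb_imply -ltnNge -dvdpE => /andP[qf sq1].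
have sq : (size q < n)%N.
  by apply: leq_ltn_trans (size_npoly q) _; rewrite -ltnS prednK // ltnW.
have [P PP Pq] := IH _ sq sq1.
by exists P => //; apply: dvdp_trans qf.
Qed.

Lemma smooth_poly_dvd m f g : smooth_poly m f -> g %| f -> smooth_poly m g.
Proof. by move=> sf gf P Pi Pg; apply: sf => //; apply: dvdp_trans gf. Qed.

Lemma irreds_monic m P : P \in irreds m -> P \is monic.
Proof. by rewrite mem_irreds => /and3P[]. Qed.

Lemma irreds_irreducible m P : P \in irreds m -> irreducible_poly P.
Proof. by rewrite mem_irreds => /and3P[_ /irreducibleP]. Qed.

Lemma irreds_eq m P Q : P \in irreds m -> Q \in irreds m -> P %| Q -> P = Q.
Proof.
move=> Pm Qm PQ; have [sP _] := irreds_irreducible Pm.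
have [_ HQ] := irreds_irreducible Qm.
apply/eqP; rewrite -eqp_monic ?(irreds_monic Pm) ?(irreds_monic Qm) //.
by apply: HQ => //; rewrite gtn_eqF.
Qed.

Lemma smooth_polyM m P g :
  P \in irreds m -> smooth_poly m g -> smooth_poly m (P * g).
Proof.
move=> Pm sg Q Qi QPg; have Pi := irreds_irreducible Pm.
have [cQP|] := boolP (coprimep Q P).
  by apply: sg => //; rewrite -(Gauss_dvdpr _ cQP).
rewrite irreducible_poly_coprime // negbK => QP.
have := dvdp_leq (irredp_neq0 Pi) QP.
move: Pm; rewrite mem_irreds => /and3P[_ _ sP] sQP.
by rewrite -subn1 leq_subLR add1n; apply: leq_trans sQP sP.
Qed.

Lemma smooth_polyXM m P j g :
  P \in irreds m -> smooth_poly m g -> smooth_poly m (P ^+ j * g).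
Proof.
move=> Pm sg; elim: j => [|j IH]; first by rewrite mul1r.
by rewrite exprS -mulrA; apply: smooth_polyM.
Qed.

(** The sum counts the powers of [P] that divide [g], so it is the multiplicity
    of [P] in [g] as soon as [N] is large enough; multiplying by the irreducible
    [Q] increases only the multiplicity of [Q], by one. *)
Lemma sum_dvd_powersM m N P Q g : P \in irreds m -> Q \in irreds m -> g != 0 ->
  (size g <= N)%N ->
  (\sum_(1 <= j < N.+1) (P ^+ j %| Q * g)%R =
   (P == Q) + \sum_(1 <= j < N.+1) (P ^+ j %| g)%R)%N.
Proof.
move=> Pm Qm g0 sg; have Pi := irreds_irreducible Pm.
have [PQ|nPQ] := eqVneq P Q; last first.
  apply: eq_bigr => j _; congr (nat_of_bool _); apply: Gauss_dvdpr.
  apply: coprimep_expl; rewrite irreducible_poly_coprime //.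
  by apply: contraNN nPQ => /(irreds_eq Pm Qm) ->.
have P0 := irredp_neq0 Pi; rewrite -PQ.
have -> : (\sum_(1 <= j < N.+1) (P ^+ j %| P * g)%R =
  \sum_(0 <= j < N) (P ^+ j %| g)%R)%N.
  rewrite big_add1 /=; apply: eq_bigr => j _.
  by rewrite exprS dvdp_mul2l.
have N0 : (0 < N)%N by apply: leq_trans sg; rewrite size_poly_gt0.
rewrite big_ltn // expr0 dvd1p; congr (_ + _)%N.
rewrite big_nat_recr //=; suff /negPf -> : ~~ (P ^+ N %| g) by rewrite addn0.
apply/negP => /(dvdp_leq g0) le; have [sP _] := Pi.
suff: (N < N)%N by rewrite ltnn.
apply: leq_trans (leq_trans le sg); rewrite polySpred ?expf_neq0 // ltnS.
by rewrite size_exp leq_pmull // -ltnS prednK // ltnW.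
Qed.

(** Unique factorization, in the only form needed: the degree is the sum of the
    degrees of the irreducible factors counted with multiplicity. *)
Lemma degree_eq_sum_valuations m N f : f \is monic -> smooth_poly m f ->
  (size f <= N.+1)%N ->
  (size f).-1 = (\sum_(P <- irreds m)
     (size P).-1 * \sum_(1 <= j < N.+1) (P ^+ j %| f)%R)%N.
Proof.
have [n] := ubnP (size f); elim: n f => // n IH f sfn fm sf sfN.
have f0 := monic_neq0 fm.
have [sf1|sf1] := leqP (size f) 1.
  have -> : f = 1.
    apply/eqP; rewrite -eqp_monic ?monic1 // -size_poly_eq1 eqn_leq sf1.
    by rewrite size_poly_gt0.
  rewrite size_poly1 big_seq big1 // => P Pm.
  rewrite big_nat big1 ?muln0 // => -[//|j] _.
  have [sP _] := irreds_irreducible Pm.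
  apply/eqP; rewrite eqb0 dvdp1; apply/eqP => /(congr1 predn).
  rewrite size_exp => /eqP; rewrite muln_eq0 orbF -leqn0 -ltnS prednK.
    by rewrite leqNgt sP.
  exact: ltnW.
have [Q /andP[Qm Qi] Qf] := irreducible_divisor sf1.
have Qirr : Q \in irreds m.
  have := sf Q (irreducibleP _ Qi) Qf.
  by rewrite mem_irreds Qm Qi -subn1 leq_subLR add1n.
have [sQ _] := irreds_irreducible Qirr.
have [g fE] : exists g, f = Q * g.
  by have /dvdpP[g] := Qf; exists g; rewrite mulrC.
have g0 : g != 0 by apply: contraNneq f0 => g0; rewrite fE g0 mulr0.
have gm : g \is monic by rewrite -(monicMl _ Qm) -fE.
have Q0 := monic_neq0 Qm.
have szf : size f = ((size Q).-1 + size g)%N.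
  by rewrite fE size_mul // {1}(polySpred Q0) addSn.
have dQ : (0 < (size Q).-1)%N by rewrite -ltnS -polySpred.
have gf_lt : (size g < size f)%N by rewrite szf -add1n leq_add2r.
have gN : (size g <= N)%N by rewrite -ltnS (leq_trans gf_lt).
have gf : g %| f by rewrite fE dvdp_mull.
have gE : (size g).-1 = (\sum_(P <- irreds m)
     (size P).-1 * \sum_(1 <= j < N.+1) (P ^+ j %| g)%R)%N.
  by apply: IH gm (smooth_poly_dvd sf gf) (leqW gN); apply: leq_trans gf_lt sfn.
rewrite (eq_big_seq (fun P => (size P).-1 * (P == Q) + 
  (size P).-1 * \sum_(1 <= j < N.+1) (P ^+ j %| g)%R)%N); last first.
  by move=> P Pm; rewrite -mulnDr fE (sum_dvd_powersM Pm Qirr).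
rewrite big_split /= -gE (bigD1_seq Q) ?irreds_uniq //= eqxx muln1.
rewrite big1 => [|P /negPf ->]; last by rewrite muln0.
by rewrite addn0 szf {1}(polySpred g0) addnS.
Qed.

Definition nsmooth_poly m n : nat :=
  count (fun f : {poly F} => `[< smooth_poly m f >]) (monics n).

Lemma irreds_deg_gt0 m P : P \in irreds m -> (0 < (size P).-1)%N.
Proof.
move=> Pm; have [sP _] := irreds_irreducible Pm.
by rewrite -ltnS prednK // ltnW.
Qed.

Lemma irreds_deg_le m P : P \in irreds m -> ((size P).-1 <= m)%N.
Proof.
by rewrite mem_irreds => /and3P[_ _]; rewrite -subn1 leq_subLR add1n.
Qed.

(** Multiplication by [P ^+ j] is a bijection from the smooth polynomials of
    degree [n - deg P * j], because [P] itself is smooth. *)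
Lemma count_smooth_multiples m n P j : P \in irreds m ->
  count (fun f => `[< smooth_poly m f >] && (P ^+ j %| f)) (monics n) =
  (if (size P).-1 * j <= n then nsmooth_poly m (n - (size P).-1 * j) else 0)%N.
Proof.
move=> Pm; set d := ((size P).-1 * j)%N.
have PXm : P ^+ j \is monic by apply: monic_exp; apply: irreds_monic Pm.
have szPX : size (P ^+ j) = d.+1.
  by rewrite (polySpred (monic_neq0 PXm)) size_exp.
have [dn|nd] := leqP d n; last first.
  rewrite -size_filter; apply/eqP; rewrite size_eq0; apply/eqP.
  rewrite -(@filter_pred0 _ (monics n)); apply: eq_in_filter => f.
  rewrite mem_monics => /andP[fm /eqP sf] /=; apply/negP => /andP[_].
  by move/(dvdp_leq (monic_neq0 fm)); rewrite szPX sf ltnS leqNgt nd.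
rewrite /nsmooth_poly -!size_filter -[RHS](size_map (fun g => P ^+ j * g)).
apply: perm_size; apply: uniq_perm.
- by rewrite filter_uniq ?monics_uniq.
- rewrite map_inj_uniq ?filter_uniq ?monics_uniq //.
  by apply: mulfI; apply: monic_neq0.
move=> f; rewrite mem_filter mem_monics; apply/idP/mapP.
  case/andP=> /andP[/asboolP sf /dvdpP[g fE]] /andP[fm /eqP szf].
  have gm : g \is monic by rewrite -(monicMr _ PXm) -fE.
  exists g; last by rewrite mulrC.
  rewrite mem_filter mem_monics gm andTb; apply/andP; split.
    by apply/asboolP; apply: smooth_poly_dvd sf _; rewrite fE dvdp_mulr.
  move: szf; rewrite fE mulrC size_monicM ?monic_neq0 // szPX addSn /=.
  by move=> e; rewrite -(eqn_add2l d) e addnS subnKC.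
case=> g; rewrite mem_filter mem_monics.
case/andP=> /asboolP sg /andP[gm /eqP szg] ->.
rewrite dvdp_mulr // andbT monicMl // gm.
rewrite size_monicM ?monic_neq0 // szPX szg addSn addnS subnKC // eqxx !andbT.
by apply/asboolP; apply: smooth_polyXM Pm sg.
Qed.

(** The coefficient of [u ^ i] in [u * G'(u) / G(u)], where [G] is the generating
    function of the numbers of smooth polynomials. *)
Definition weight m i : nat :=
  (\sum_(P <- irreds m | (size P).-1 %| i) (size P).-1)%N.

(** Both sides add up [deg P] over the triples (f, P, j) with [f] smooth of degree
    [n] and [P ^+ j] dividing [f]; the index [i] on the right is [deg P * j]. *)
Lemma nsmooth_poly_rec m n :
  (n * nsmooth_poly m n =
   \sum_(1 <= i < n.+1) weight m i * nsmooth_poly m (n - i))%N.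
Proof.
pose sm f := `[< smooth_poly m f >].
transitivity (\sum_(f <- monics n | sm f) n)%N.
  by rewrite big_const_seq iter_addn_0.
transitivity (\sum_(f <- monics n | sm f) \sum_(P <- irreds m)
     (size P).-1 * \sum_(1 <= j < n.+1) (P ^+ j %| f)%R)%N.
  rewrite big_seq_cond [RHS]big_seq_cond; apply: eq_bigr => f.
  rewrite mem_monics => /andP[/andP[fm /eqP szf] /asboolP sf].
  by rewrite -degree_eq_sum_valuations // szf.
rewrite exchange_big /=.
transitivity (\sum_(P <- irreds m) \sum_(1 <= i < n.+1)
    ((size P).-1 %| i) * (size P).-1 * nsmooth_poly m (n - i))%N; last first.
  rewrite exchange_big /=; apply: eq_bigr => i _.
  rewrite /weight big_distrl /= [RHS]big_mkcond; apply: eq_bigr => P _.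
  by case: (_ %| _)%N; rewrite ?mul1n ?mul0n.
apply: eq_big_seq => P Pm; set d := (size P).-1.
have d0 : (0 < d)%N := irreds_deg_gt0 Pm.
rewrite -big_distrr /= exchange_big /=.
transitivity (d * \sum_(1 <= j < n.+1) \sum_(1 <= i < n.+1)
   (i == d * j) * nsmooth_poly m (n - i))%N.
  congr (_ * _)%N; rewrite big_nat [RHS]big_nat; apply: eq_bigr => j /andP[j1 _].
  rewrite (eq_bigr (fun f => if P ^+ j %| f then 1%N else 0%N)); last first.
    by move=> f _; case: (_ %| _).
  rewrite -big_mkcondr sum1_count count_smooth_multiples // -/d.
  have [djn|ndj] := leqP (d * j) n; last first.
    rewrite big_nat big1 // => i /andP[_]; rewrite ltnS => le_in.
    by rewrite ltn_eqF // (leq_ltn_trans le_in).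
  rewrite (bigD1_seq (d * j)%N) ?iota_uniq //=; last first.
    by rewrite mem_index_iota ltnS djn andbT muln_gt0 d0.
  by rewrite eqxx mul1n big1 ?addn0 // => i /negPf ->.
rewrite exchange_big big_distrr /= big_nat [RHS]big_nat.
apply: eq_bigr => i /andP[i1 ilt]; rewrite -big_distrl /= mulnA.
congr (_ * _)%N; rewrite mulnC; congr (_ * _)%N.
have [/dvdnP[k ik]|ndi] := boolP (d %| i)%N; last first.
  rewrite big1 // => j _; apply/eqP; rewrite eqb0; apply: contraNN ndi => /eqP ->.
  exact: dvdn_mulr.
rewrite (bigD1_seq k) ?iota_uniq //=; last by rewrite mem_index_iota; nia.
rewrite ik mulnC eqxx big1 // => j /negPf jk.
by rewrite eqn_pmul2l // eq_sym jk.
Qed.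

(** An irreducible factor cannot have a larger degree than the polynomial. *)
Lemma nsmooth_poly_all m n : (n <= m)%N -> nsmooth_poly m n = (#|F| ^ n)%N.
Proof.
move=> nm; rewrite -size_monics; apply/eqP; rewrite -all_count.
apply/allP => f; rewrite mem_monics => /andP[fm /eqP szf].
apply/asboolP => P _ /(dvdp_leq (monic_neq0 fm)); rewrite szf => sP.
by rewrite -subn1 leq_subLR add1n (leq_trans sP).
Qed.

Lemma nsmooth_poly_le m n : (nsmooth_poly m n <= #|F| ^ n)%N.
Proof. by rewrite -size_monics count_size. Qed.

(** For [k <= m] the recurrence becomes
    [\sum_(1 <= i <= k) weight m i * q ^ (k - i) = k * q ^ k]; subtracting [q]
    times the equation for [k - 1] from it isolates [weight m k]. *)
Lemma weight_small m n : (0 < n <= m)%N -> weight m n = (#|F| ^ n)%N.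
Proof.
have key k : (k <= m)%N ->
    (\sum_(1 <= i < k.+1) weight m i * #|F| ^ (k - i) = k * #|F| ^ k)%N.
  move=> km; rewrite -(nsmooth_poly_all km) nsmooth_poly_rec.
  rewrite big_nat [RHS]big_nat; apply: eq_bigr => i ik.
  by rewrite nsmooth_poly_all //; lia.
case: n => [//|n] /= nm; have := key _ nm.
rewrite big_nat_recr //= subnn expn0 muln1.
rewrite big_nat (eq_bigr (fun i => (#|F| * (weight m i * #|F| ^ (n - i)))%N)).
  rewrite -big_nat -big_distrr /= key ?(ltnW nm) //.
  by rewrite mulnCA -expnS mulSn addnC => /addIn.
move=> i /andP[_ ile]; rewrite subSn; first by rewrite expnS mulnCA.
by rewrite -ltnS.
Qed.

Lemma sum_expn_le q K : (1 < q)%N -> (\sum_(1 <= k < K.+1) q ^ k <= 2 * q ^ K)%N.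
Proof.
move=> q1; elim: K => [|K IH]; first by rewrite big_geq.
rewrite big_nat_recr //= expnS; nia.
Qed.

(** A divisor of [i] that is at most [m] is smaller than [i], hence at most
    [i./2]; the irreducible polynomials of degree [k <= m] contribute at most
    [weight m k = q ^ k]. *)
Lemma weight_large m i : (m < i)%N -> (weight m i <= 2 * #|F| ^ i./2)%N.
Proof.
move=> mi; apply: leq_trans (sum_expn_le i./2 (card_finNzRing_gt1 F)).
apply: (@leq_trans (\sum_(P <- irreds m) \sum_(1 <= k < i./2.+1)
    ((size P).-1 == k) * (size P).-1)%N).
  rewrite /weight big_mkcond big_seq [X in (_ <= X)%N]big_seq.
  apply: leq_sum => P Pm; case: ifP => // /dvdnP[c ic].
  have d0 := irreds_deg_gt0 Pm; have dm := irreds_deg_le Pm.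
  rewrite (bigD1_seq (size P).-1) ?iota_uniq ?eqxx ?mul1n ?leq_addr //=.
  rewrite mem_index_iota d0 /= ltnS; move: (size P).-1 d0 dm ic => d d0 dm ic.
  rewrite -(doubleK d) half_leq // -mul2n ic leq_mul2r ltnNge.
  apply/orP; right; apply: contraL mi => c1.
  by rewrite -leqNgt ic (leq_trans _ dm) // -{2}(mul1n d) leq_mul2r c1 orbT.
rewrite exchange_big /= big_nat [X in (_ <= X)%N]big_nat.
apply: leq_sum => k /andP[k0 _].
have [km|mk] := leqP k m; last first.
  rewrite big_seq big1 // => P /irreds_deg_le dm.
  by rewrite ltn_eqF ?(leq_ltn_trans dm mk).
rewrite -(weight_small (n := k) (m := m)) ?k0 // /weight [X in (_ <= X)%N]big_mkcond.
apply: leq_sum => P _; have [->|] := eqVneq; last by rewrite mul0n.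
by rewrite dvdnn mul1n.
Qed.

End PolynomialCount.

(** * Counting smooth permutations *)

Section PermutationCount.
Local Open Scope nat_scope.
Local Open Scope group_scope.
Variable T : finType.
Implicit Types (s t c : {perm T}) (A B D : {set T}) (x y : T) (m n : nat).

(** Orbits can be computed in any permutation that agrees on a stable set. *)
Lemma eq_in_porbit D s t x : {in D, s =1 t} -> {in D, forall y, t y \in D} ->
  x \in D -> porbit s x = porbit t x.
Proof.
move=> st tD xD.
have E i : (s ^+ i) x = (t ^+ i) x /\ (t ^+ i) x \in D.
  elim: i => [|i [IH1 IH2]]; first by rewrite !expg0 perm1.
  by rewrite !expgSr !permM IH1 st // tD.
apply/setP => y; apply/porbitP/porbitP => -[i ->]; exists i; by case: (E i).
Qed.

Lemma porbit_fixed s x : s x = x -> #|porbit s x| = 1%N.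
Proof.
move=> sx; rewrite -(cards1 x); apply: eq_card => y; rewrite inE.
apply/porbitP/eqP => [[i ->]|->]; last by exists 0; rewrite expg0 perm1.
by elim: i => [|i IH]; rewrite ?expg0 ?perm1 // expgSr permM IH.
Qed.

Definition nsmooth_perm m A : nat :=
  #|[set s in Sym A | `[< smooth_perm m s >]]|.

(** For [x] in [A], the number of permutations of [A] that are a single
    cycle. *)
Definition ntransitive A x : nat := #|[set s in Sym A | porbit s x == A]|.

Lemma smooth_permP m s :
  reflect (forall x, #|porbit s x| <= m)%N `[< smooth_perm m s >].
Proof.
apply: (iffP (asboolP _)) => [sm x|sm c /imsetP[x _ ->]//].
by apply: sm; apply: imset_f.
Qed.

(** A permutation of [A] with orbit [B] at [x] factors uniquely as [c * t] with
    [c] a cycle on [B] and [t] supported in the complement of [B]. *)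
Lemma card_smooth_with_orbit m A B x : (0 < m)%N -> x \in B -> B \subset A ->
  #|[set s in Sym A | `[< smooth_perm m s >] & porbit s x == B]| =
  ((#|B| <= m) * (ntransitive B x * nsmooth_perm m (A :\: B)))%N.
Proof.
move=> m0 xB BA.
have [Bm|mB] := leqP #|B| m; last first.
  rewrite mul0n; apply/eqP; rewrite cards_eq0; apply/eqP/setP => s.
  rewrite !inE; apply/negP => /and3P[_ /smooth_permP sm /eqP sB].
  by have := sm x; rewrite sB leqNgt mB.
rewrite mul1n /ntransitive /nsmooth_perm -cardsX.
have onB c t y : c \in Sym B -> t \in Sym (A :\: B) -> y \in B -> (c * t) y = c y.
  rewrite !inE => cB tB yB; rewrite permM (out_perm tB) //.
  by rewrite inE (perm_closed _ cB) yB.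
have offB c t y : c \in Sym B -> t \in Sym (A :\: B) -> y \notin B ->
    (c * t) y = t y.
  by rewrite !inE => cB tB yB; rewrite permM (out_perm cB).
rewrite -(@card_in_imset _ _ (fun ct => ct.1 * ct.2)); last first.
  move=> [c t] [c' t']; rewrite !in_setX /=.
  rewrite inE [in X in _ && X]inE => /andP[/andP[cB _] /andP[tB _]].
  rewrite inE [in X in _ && X]inE => /andP[/andP[cB' _] /andP[tB' _]] e.
  have cc : c = c'.
    apply/permP => y; have [yB|yB] := boolP (y \in B).
      by rewrite -(onB c t) // -(onB c' t') // e.
    by move: cB cB'; rewrite !inE => h h'; rewrite (out_perm h) ?(out_perm h').
  by rewrite cc in e *; rewrite (mulgI _ _ _ e).
apply: eq_card => s; rewrite inE; apply/idP/imsetP.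
  case/and3P => sA /smooth_permP sm /eqP sB.
  have sBy y : (s y \in B) = (y \in B).
    by rewrite -sB -!eq_porbit_mem; have := porbit_perm s 1 y; rewrite expg1 => ->.
  have sN : s \in 'N(B | 'P).
    rewrite inE; apply/andP; split; first by rewrite inE.
    by rewrite inE; apply/subsetP => y yB; rewrite inE /= apermE sBy.
  pose c := restr_perm B s; pose t := c^-1 * s.
  have cB : perm_on B c by apply: restr_perm_on.
  have cE : {in B, c =1 s} by move=> y yB; apply: restr_permE.
  have tE1 y : y \in B -> t y = y.
    move=> yB; rewrite permM -cE ?permKV //.
    by rewrite (perm_closed _ (perm_onV cB)).
  have tE2 y : y \notin B -> t y = s y.
    by move=> yB; rewrite permM (out_perm (perm_onV cB)).
  exists (c, t); last by rewrite /= mulKVg.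
  rewrite in_setX /= !inE cB /=; apply/and3P; split.
  - by rewrite (eq_in_porbit cE) ?sB // => y; rewrite sBy.
  - apply/subsetP => y; rewrite !inE => ty.
    have yB : y \notin B by apply: contraNN ty => /tE1 ->.
    rewrite yB; apply: contraR ty => yA; rewrite tE2 //.
    by move: sA; rewrite inE => /out_perm ->.
  - apply/smooth_permP => y; have [yB|yB] := boolP (y \in B).
      by rewrite porbit_fixed ?tE1.
    rewrite (@eq_in_porbit (~: B) t s) ?inE // => z; rewrite !inE ?sBy //.
    by move/tE2.
case=> -[c t]; rewrite in_setX /= inE [in X in _ && X]inE.
case/andP=> /andP[cB /eqP cx] /andP[tB /smooth_permP tm] ->.
have cB' : perm_on B c by move: cB; rewrite inE.
have tB' : perm_on (A :\: B) t by move: tB; rewrite inE.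
have orbB y : y \in B -> porbit (c * t) y = B.
  move=> yB; rewrite (@eq_in_porbit B _ c) //.
  - by apply/eqP; rewrite -cx eq_porbit_mem cx.
  - by move=> z zB; apply: onB.
  - by move=> z; rewrite (perm_closed _ cB').
apply/and3P; split; last by rewrite orbB.
  rewrite inE perm_onM //; first by apply: subset_trans BA.
  by apply: subset_trans tB' (subsetDl _ _).
apply/smooth_permP => y; have [yB|yB] := boolP (y \in B).
  by rewrite orbB.
rewrite (@eq_in_porbit (~: B) _ t) ?inE // => z; rewrite !inE => zB.
  exact: offB.
apply: contraNN zB => tz; rewrite -(permK t z) (out_perm (perm_onV tB')) //.
by rewrite inE tz.
Qed.

Lemma nsmooth_perm_orbit_sum m A x : (0 < m)%N -> x \in A ->
  nsmooth_perm m A = (\sum_(B : {set T} | (x \in B) && (B \subset A))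
    (#|B| <= m) * (ntransitive B x * nsmooth_perm m (A :\: B)))%N.
Proof.
move=> m0 xA; rewrite /nsmooth_perm -sum1_card.
rewrite (partition_big (fun s => porbit s x)
  (fun B : {set T} => (x \in B) && (B \subset A))) /=; last first.
  move=> s; rewrite inE => /andP[sA _]; rewrite porbit_id /=.
  move: sA; rewrite inE => sA.
  apply/subsetP => y /porbitP[i ->].
  elim: i => [|i IH]; first by rewrite expg0 perm1.
  by rewrite expgSr permM (perm_closed _ sA).
apply: eq_bigr => B /andP[xB BA]; rewrite -card_smooth_with_orbit //.
by rewrite -sum1_card; apply: eq_bigl => s; rewrite !inE andbA.
Qed.

Lemma sum_card_subsets A (f : nat -> nat) :
  (\sum_(B : {set T} | B \subset A) f #|B| =
   \sum_(k < #|A|.+1) 'C(#|A|, k) * f k)%N.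
Proof.
rewrite (partition_big (fun B : {set T} => inord #|B| : 'I_#|A|.+1) predT) //=.
apply: eq_bigr => k _.
rewrite -cards_draws -sum_nat_const; apply: eq_big => [B|B].
  rewrite inE; have [BA|//] := boolP (B \subset A).
  by rewrite -val_eqE /= inordK // ltnS subset_leq_card.
case/andP=> BA /eqP <-; rewrite inordK // ltnS subset_leq_card //.
Qed.

Lemma sum_card_subsets_containing A x n (f : nat -> nat) :
  x \in A -> #|A| = n.+1 ->
  (\sum_(B : {set T} | (x \in B) && (B \subset A)) f #|B|.-1 =
   \sum_(k < n.+1) 'C(n, k) * f k)%N.
Proof.
move=> xA cA; have cA' : #|A :\ x| = n.
  by move: (cardsD1 x A); rewrite xA cA add1n => -[].
rewrite -cA' -sum_card_subsets.
rewrite (reindex_onto (fun B => x |: B) (fun B => B :\ x)) /=; last first.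
  by move=> B /andP[xB _]; rewrite setD1K.
have E (B : {set T}) : (x \in x |: B) && (x |: B \subset A) &&
    ((x |: B) :\ x == B) = (B \subset A :\ x).
  rewrite setU11 /= subUset sub1set xA /= subsetD1.
  congr andb; apply/eqP/idP => [<-|]; first by rewrite !inE eqxx.
  exact: setU1K.
apply: eq_big => // B; rewrite E subsetD1 => /andP[_ xB].
by rewrite cardsU1 xB.
Qed.

(** The orbit decomposition of all the permutations of [A] determines the number
    of single cycles on [A] from those on the proper subsets, and
    [(#|A|.-1)`!] satisfies the same equation; so no explicit enumeration of the
    cycles is needed. *)
Lemma ntransitiveE A x : x \in A -> ntransitive A x = (#|A|.-1)`!.
Proof.
have [n] := ubnP #|A|; elim: n A => // n IH A cAn xA.
have [a cA] : exists a, #|A| = a.+1.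
  by exists #|A|.-1; rewrite prednK // (cardD1 x) xA.
(* With the bound #|T| every permutation is smooth. *)
have all_smooth B : nsmooth_perm #|T| B = (#|B|)`!.
  rewrite -card_Sym; apply: eq_card => s; rewrite inE.
  suff -> : `[< smooth_perm #|T| s >] by rewrite andbT.
  by apply/smooth_permP => y; apply: max_card.
have T0 : (0 < #|T|)%N by apply/card_gt0P; exists x.
have E1 := nsmooth_perm_orbit_sum T0 xA.
have E2 : (#|A|`! = \sum_(B : {set T} | (x \in B) && (B \subset A))
    (#|B|.-1)`! * (a - #|B|.-1)`!)%N.
  rewrite (sum_card_subsets_containing (fun k => k`! * (a - k)`!)%N xA cA) cA.
  rewrite (eq_bigr (fun=> a`!)) => [|k _]; last by rewrite bin_fact // -ltnS.
  by rewrite sum_nat_const card_ord factS.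
(* By induction the two sums agree on the proper subsets: compare the terms B = A. *)
move: E1; rewrite all_smooth E2 (bigD1 A) /=; last by rewrite xA subxx.
rewrite [X in _ = X -> _](bigD1 A) /=; last by rewrite xA subxx.
rewrite cA /= subnn setDv all_smooth cards0 !muln1 -cA max_card mul1n.
rewrite [X in (_ + X = _)%N](_ : _ =
  (\sum_(B : {set T} | (x \in B) && (B \subset A) && (B != A))
    (#|B| <= #|T|) * (ntransitive B x * nsmooth_perm #|T| (A :\: B)))%N);
  last first.
  apply: eq_bigr => B /andP[/andP[xB BA] nBA].
  have BA' : B \proper A by rewrite properEneq nBA.
  rewrite max_card mul1n IH // ?all_smooth; last first.
    by apply: leq_trans (proper_card BA') _; rewrite -ltnS.
  congr (_ * _`!)%N; rewrite cardsD (setIidPr BA) cA.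
  by rewrite (cardsD1 x B) xB.
by move=> /addIn <-.
Qed.

Lemma nsmooth_perm_card0 m A : (0 < m)%N -> #|A| = 0%N -> nsmooth_perm m A = 1%N.
Proof.
move=> m0 /cards0_eq ->; rewrite -(cards1 (1 : {perm T})).
apply: eq_card => s; rewrite !inE; apply/andP/eqP => [[s0 _]|->].
  by apply: perm_on_id s0 _; rewrite cards0.
split; first exact: perm_on1.
by apply/smooth_permP => y; rewrite porbit_fixed ?perm1.
Qed.

Lemma nsmooth_perm_sum m A x n (g : nat -> nat) : (0 < m)%N ->
  x \in A -> #|A| = n.+1 ->
  (forall B : {set T}, x \in B -> B \subset A ->
    nsmooth_perm m (A :\: B) = g (n - #|B|.-1)%N) ->
  nsmooth_perm m A = (\sum_(k < n.+1) 'C(n, k) * ((k < m) * (k`! * g (n - k))))%N.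
Proof.
move=> m0 xA cA Hg; rewrite (nsmooth_perm_orbit_sum m0 xA).
rewrite -(sum_card_subsets_containing
  (fun k => (k < m) * (k`! * g (n - k)))%N xA cA).
apply: eq_bigr => B /andP[xB BA]; rewrite ntransitiveE // Hg //.
by congr (nat_of_bool _ * _)%N; rewrite prednK // (cardD1 x) xB.
Qed.

End PermutationCount.

(** Removing a cycle from a permutation of ['I_n] leaves a permutation of a subset
    of ['I_n]; this lemma brings it back to an ordinal type.  The decomposition
    along orbits determines the count from smaller sets through cardinals only,
    so induction replaces the transport of permutations along a bijection. *)
Lemma nsmooth_perm_ord (T : finType) m (A : {set T}) : (0 < m)%N ->
  nsmooth_perm m A = nsmooth_perm m [set: 'I_#|A|].
Proof.
move=> m0; have [n] := ubnP #|A|; elim: n T A => // n IH T A cAn.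
case cA : #|A| => [|a].
  by rewrite !nsmooth_perm_card0 // cardsT card_ord.
have [x xA] : exists x, x \in A by apply/card_gt0P; rewrite cA.
pose g k := nsmooth_perm m [set: 'I_k].
have key (T' : finType) (A' : {set T'}) y : y \in A' -> #|A'| = a.+1 ->
    nsmooth_perm m A' = (\sum_(k < a.+1) 'C(a, k) * ((k < m) * (k`! * g (a - k))))%N.
  move=> yA cA'; apply: (nsmooth_perm_sum m0 yA cA') => B yB BA.
  have cE : #|A' :\: B| = (a - #|B|.-1)%N.
    by rewrite cardsD (setIidPr BA) cA' (cardsD1 y B) yB.
  rewrite IH ?cE //; move: cAn; rewrite cA; lia.
by rewrite (key _ _ x) // (key _ _ ord0) // cardsT card_ord.
Qed.

Lemma nsmooth_perm_rec m n : (0 < m)%N ->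
  nsmooth_perm m [set: 'I_n.+1] = (\sum_(k < n.+1) 'C(n, k) *
     ((k < m) * (k`! * nsmooth_perm m [set: 'I_(n - k)])))%N.
Proof.
move=> m0.
apply: (@nsmooth_perm_sum _ _ _ ord0 n (fun k => nsmooth_perm m [set: 'I_k])) => //.
  by rewrite cardsT card_ord.
move=> B xB _; rewrite nsmooth_perm_ord //; congr (nsmooth_perm _ [set: 'I_ _]).
by rewrite cardsD setTI cardsT card_ord (cardsD1 ord0 B) xB.
Qed.

(** * Comparison of the two recurrences *)

Section Comparison.
Variable R : realFieldType.

(** If [v - u] is at most [S / m.+1] before [n.+1], then, as it vanishes up to [m],
    the first part of the recurrence for [n.+1] has at most [n - m] nonzero
    terms; so [n.+1] times the next difference is at most
    [(n - m) * S / m.+1 + S = n.+1 * (S / m.+1)], and the induction closes with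
    no loss. *)
Lemma recurrence_comparison (m : nat) (u v a : nat -> R) (S : R) :
  u 0 = v 0 ->
  (forall n, n.+1%:R * u n.+1 = \sum_(k < n.+1) (k < m)%:R * u (n - k)%N) ->
  (forall n, n.+1%:R * v n.+1 = \sum_(k < n.+1) a k.+1 * v (n - k)%N) ->
  (forall i, (0 < i <= m)%N -> a i = 1) ->
  (forall i, 0 <= a i) ->
  (forall n, 0 <= v n <= 1) ->
  (forall n, \sum_(k < n) (m <= k)%:R * a k.+1 <= S) ->
  forall n, 0 <= v n - u n <= S / m.+1%:R.
Proof.
move=> uv0 uE vE a1 a0 v01 aS.
pose D n := v n - u n.
have DE n : n.+1%:R * D n.+1 = \sum_(k < n.+1)
    ((k < m)%:R * D (n - k)%N + (m <= k)%:R * (a k.+1 * v (n - k)%N)).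
  rewrite mulrBr uE vE -sumrB; apply: eq_bigr => k _; rewrite /D.
  have [km|mk] := ltnP k m; rewrite /= !(mul1r, mul0r, addr0, add0r, subr0) //.
  by rewrite a1 // mul1r.
have D0 : D 0 = 0 by rewrite /D uv0 subrr.
have n0 n : 0 < n.+1%:R :> R by rewrite ltr0Sn.
have Dge0 n : 0 <= D n.
  elim/ltn_ind: n => -[|n] IH; first by rewrite D0.
  rewrite -(pmulr_rge0 _ (n0 n)) DE; apply: sumr_ge0 => k _.
  have /andP[v0 _] := v01 (n - k)%N.
  apply: addr_ge0; apply: mulr_ge0; rewrite ?ler0n ?mulr_ge0 //.
  by apply: IH; lia.
have Dsmall n : (n <= m)%N -> D n = 0.
  elim/ltn_ind: n => -[|n] IH nm //.
  apply: (mulfI (lt0r_neq0 (n0 n))); rewrite DE mulr0 big1 // => k _.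
  have km : (k < m)%N by apply: leq_trans nm.
  by rewrite [(m <= k)%N]leqNgt km IH ?mul0r ?mulr0 ?addr0 //; lia.
have S0 : 0 <= S by have := aS 0; rewrite big_ord0.
pose M := S / m.+1%:R.
have ME : S = m.+1%:R * M by rewrite /M mulrC divfK // lt0r_neq0.
have M0 : 0 <= M by rewrite /M divr_ge0.
move=> n; apply/andP; split; first exact: Dge0.
rewrite -/(D n) -/M.
elim/ltn_ind: n => n IH.
have [nm|mn] := leqP n m; first by rewrite Dsmall.
case: n mn IH => // n; rewrite ltnS => mn IH.
rewrite -(ler_pM2l (n0 n)) DE.
apply: (@le_trans _ _ (\sum_(k < n.+1) (k < n - m)%:R * M +
   \sum_(k < n.+1) (m <= k)%:R * a k.+1)).
  rewrite -big_split; apply: ler_sum => k _ /=; apply: lerD; last first.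
    apply: ler_wpM2l => //; have /andP[_ v1] := v01 (n - k)%N.
    by apply: ler_piMr.
  have [km|km] := leqP (n - k) m.
    by rewrite Dsmall // mulr0 mulr_ge0.
  have -> : (k < n - m)%N by lia.
  rewrite mul1r; case: (k < m)%N; rewrite ?mul0r // mul1r.
  by apply: IH; lia.
have -> : \sum_(k < n.+1) (k < n - m)%:R * M = (n - m)%:R * M.
  transitivity (\sum_(k < n.+1 | (k < n - m)%N) M).
    rewrite [RHS]big_mkcond; apply: eq_bigr => k _.
    by case: ifP; rewrite ?mul1r ?mul0r.
  rewrite -(big_ord_widen _ (fun=> M)); last by rewrite leqW // leq_subr.
  by rewrite sumr_const card_ord mulr_natl.
apply: le_trans (lerD (lexx _) (aS _)) _; rewrite ME -mulrDl.
by apply: ler_wpM2r => //; rewrite -natrD ler_nat; lia.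
Qed.

(** Halving every second step makes [2 * (w k + w k.+1)] a potential whose
    decrease pays for [w k]; the sum telescopes. *)
Lemma half_geometric_tail (w : nat -> R) (m n : nat) : (forall k, 0 <= w k) ->
  (forall k, w k.+1 <= w k) -> (forall k, 2 * w k.+2 <= w k) ->
  \sum_(k < n) (m <= k)%:R * w k <= 4 * w m.
Proof.
move=> w0 w1 w2; pose phi k := 2 * (w k + w k.+1).
suff H : \sum_(k < n) (m <= k)%:R * w k + phi (maxn m n) <= phi m.
  have phi0 : 0 <= phi (maxn m n) by rewrite mulr_ge0 // addr_ge0.
  have := w1 m; rewrite /phi in H phi0 *; lra.
elim: n => [|n IH]; first by rewrite big_ord0 maxn0 add0r.
rewrite big_ord_recr /=; have [mn|nm] := leqP m n.
  move: IH; rewrite (maxn_idPr mn) (maxn_idPr (leqW mn)) /phi mul1r.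
  have := w2 n; lra.
by move: IH; rewrite (maxn_idPl nm) (maxn_idPl (ltnW nm)) mul0r addr0.
Qed.

End Comparison.

(** * The two probabilities *)

Section SmoothProbabilities.
Variables (R : realType) (F : finFieldType) (m : nat).
Hypothesis m_gt0 : (0 < m)%N.

Definition perm_prob n : R :=
  unif_prob R [set: 'S_n] (fun s => smooth_perm m s).

Definition poly_prob n : R :=
  unif_prob R (monic_of_degree F n) (fun f => smooth_poly m (polyn f)).

Lemma perm_probE n : perm_prob n = (nsmooth_perm m [set: 'I_n])%:R / n`!%:R.
Proof.
rewrite /perm_prob /unif_prob cardsT card_Sn; congr (_%:R / _).
apply: eq_card => s; rewrite inE [RHS]inE; congr andb; rewrite !inE.
by symmetry; apply/subsetP => x _; rewrite inE.
Qed.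

Lemma poly_probE n : poly_prob n = (nsmooth_poly F m n)%:R / #|F|%:R ^+ n.
Proof.
rewrite /poly_prob /unif_prob card_monic_of_degree natrX; congr (_%:R / _).
rewrite /nsmooth_poly -sum1_count big_map big_enum_cond sum1dep_card.
by apply: eq_card => f; rewrite !inE.
Qed.

Lemma perm_prob_rec n :
  n.+1%:R * perm_prob n.+1 = \sum_(k < n.+1) (k < m)%:R * perm_prob (n - k).
Proof.
rewrite perm_probE nsmooth_perm_rec // factS natrM invfM mulrCA mulVKf ?pnatr_eq0 //.
rewrite natr_sum mulr_suml; apply: eq_bigr => k _.
have kn : (k <= n)%N by rewrite -ltnS.
rewrite perm_probE -(bin_fact kn) !natrM.
have f0 j : j`!%:R != 0 :> R by rewrite pnatr_eq0 -lt0n fact_gt0.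
have c0 : 'C(n, k)%:R != 0 :> R by rewrite pnatr_eq0 -lt0n bin_gt0.
by field; rewrite c0 !f0.
Qed.

Definition scaled_weight i : R := (weight F m i)%:R / #|F|%:R ^+ i.

Lemma poly_prob_rec n :
  n.+1%:R * poly_prob n.+1 = \sum_(k < n.+1) scaled_weight k.+1 * poly_prob (n - k).
Proof.
rewrite poly_probE mulrA -natrM nsmooth_poly_rec big_add1 big_mkord.
rewrite natr_sum mulr_suml.
apply: eq_bigr => k _; rewrite subSS natrM poly_probE /scaled_weight.
have kn : (k <= n)%N by rewrite -ltnS.
have -> : #|F|%:R ^+ n.+1 = #|F|%:R ^+ k.+1 * #|F|%:R ^+ (n - k) :> R.
  by rewrite -exprD addSn subnKC.
by rewrite invfM mulrACA.
Qed.

Lemma smooth_prob_diff n :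
  0 <= poly_prob n - perm_prob n
    <= 8 * #|F|%:R^-1 ^+ uphalf m.+1 / m.+1%:R.
Proof.
pose q : R := #|F|%:R.
have q2 : 2 <= q by rewrite /q ler_nat card_finNzRing_gt1.
have q0 : 0 < q by lra.
have qX0 i : 0 < q ^+ i by rewrite exprn_gt0.
have qI : 0 <= q^-1 by rewrite invr_ge0 ltW.
have qI2 : 2 * q^-1 <= 1 by rewrite ler_pdivrMr // mul1r.
apply: (recurrence_comparison (a := scaled_weight)) => //.
- rewrite poly_probE perm_probE nsmooth_poly_all // nsmooth_perm_card0 //.
    by rewrite cardsT card_ord.
- exact: perm_prob_rec.
- exact: poly_prob_rec.
- by move=> i im; rewrite /scaled_weight weight_small // natrX divff // lt0r_neq0.
- by move=> i; rewrite divr_ge0 // ltW.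
- move=> i; rewrite poly_probE divr_ge0 ?(ltW (qX0 _)) //= ler_pdivrMr //.
  by rewrite mul1r -natrX ler_nat nsmooth_poly_le.
move=> k.
pose w j : R := q^-1 ^+ uphalf j.+1.
apply: (@le_trans _ _ (2 * \sum_(j < k) (m <= j)%:R * w j)).
  rewrite mulr_sumr; apply: ler_sum => j _.
  have [mj|_] := leqP m j; last by rewrite !mul0r mulr0.
  rewrite !mul1r /scaled_weight ler_pdivrMr // /w.
  (* As ceil(i / 2) + floor(i / 2) = i, the weight bound
     reads 2 / q ^ ceil(i / 2). *)
  have -> : q ^+ j.+1 = q ^+ uphalf j.+1 * q ^+ j.+1./2.
    by rewrite -exprD uphalf_half -addnA addnn odd_double_half.
  rewrite -mulrA exprVn mulKf ?lt0r_neq0 //.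
  rewrite -natrX -natrM ler_nat; apply: weight_large; exact: mj.
(* As q >= 2, w is at least halved every second step. *)
have wS j : w j.+2 = q^-1 * w j by rewrite /w -exprS.
have w_ge0 j : 0 <= w j by rewrite exprn_ge0.
have tail : \sum_(j < k) (m <= j)%:R * w j <= 4 * w m.
  apply: half_geometric_tail => // j.
    by apply: ler_wiXn2l; rewrite ?uphalf_leq //; lra.
  by rewrite wS mulrA ler_piMl.
move: tail; rewrite /w; lra.
Qed.

End SmoothProbabilities.

Theorem proposition1p5 (R : realType) :
  exists C : R, 0 < C /\
    forall (q : nat) (F : finFieldType) (n m : nat),
      #|F| = q -> (1 <= m)%N -> (m <= n)%N -> (2 <= n)%N ->
      0 <= unif_prob R (monic_of_degree F n) (fun f => smooth_poly m (polyn f))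
           - unif_prob R [set: 'S_n] (fun s => smooth_perm m s)
        <= C / (m%:R * q%:R ^+ uphalf m.+1).
Proof.
exists 8; split=> // q F n m <- m0 _ _.
have /andP[-> le] := smooth_prob_diff R F m0 n.
apply: le_trans le _; rewrite invfM exprVn -mulrA ler_pM2l // mulrC.
apply: ler_wpM2r; first by rewrite invr_ge0 exprn_ge0.
by rewrite lef_pV2 ?posrE ?ltr0n // ler_nat.
Qed.
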